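(* Let $m$ and $r$ be natural numbers with $m\ge 2r$, let $n:=mr$, and let $k\in[m]$. Let the measurement set be $\Omega=\Omega_k$. Let $\mathbf{M}^*\in\mathbb{R}^{n\times n}$ be a positive semidefinite matrix of rank $r$ and assume that the block $\mathbf{M}^*_{i,j}$ has rank $r$ for all $i,j\in[m]$. Then every second-order critical point of the problem $\min_{\mathbf{X}\in\mathbb{R}^{n\times r}}\|(\mathbf{X}\mathbf{X}^T-\mathbf{M}^* )_\Omega\|_F^2$ is a global minimum.
   Context: $[m]=\{1,\dots,m\}$. An $n\times n$ matrix $\mathbf{M}$ with $n=mr$ is divided into $m\times m$ blocks $\mathbf{M}_{i,j}$ of size $r\times r$. For $\Omega\subset[n]\times[n]$, $\mathbf{M}_\Omega$ denotes the matrix whose $(i,j)$ entry is $\mathbf{M}_{ij}$ if $(i,j)\in\Omega$ and $0$ otherwise. $\Omega_k$ is the set of all entries belonging to blocks $(i,j)\in\mathcal{E}_k:=\{(k,j),(j,k)\mid j\in[m]\}$; that is, exactly the $k$-th block row and the $k$-th block column are observed. A second-order critical point of an unconstrained problem is a point at which the gradient vanishes and the Hessian is positive semidefinite. *)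

(* Defs.v *)
From HB Require Import structures.
From mathcomp Require Export all_boot all_order all_algebra.
From mathcomp Require Export all_classical all_reals all_analysis.
Export numFieldNormedType.Exports.

Set Implicit Arguments.
Unset Strict Implicit.
Unset Printing Implicit Defensive.

Import Order.TTheory GRing.Theory Num.Theory.
Local Open Scope ring_scope.

Lemma block_index_subproof m r (i : 'I_m) (a : 'I_r) : (i * r + a < m * r)%N.
Proof.
apply: (@leq_trans (i.+1 * r)%N); first by rewrite mulSn addnC ltn_add2r.
by rewrite leq_mul2r (ltn_ord i) orbT.
Qed.

(* Row (or column) a of block row (or block column) i, as an index in 'I_(m * r).
   All indices start from 0, so [m] is 'I_m. *)
Definition block_index m r (i : 'I_m) (a : 'I_r) : 'I_(m * r) :=
  Ordinal (block_index_subproof i a).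

Definition block (R : Type) m r (M : 'M[R]_(m * r)) (i j : 'I_m) : 'M[R]_r :=
  mxsub (block_index i) (block_index j) M.

Definition block_entries m (r : nat) (e : 'I_m * 'I_m) :
    {set 'I_(m * r) * 'I_(m * r)} :=
  [set (block_index e.1 a, block_index e.2 b) | a : 'I_r, b : 'I_r].

Definition cross m (k : 'I_m) : {set 'I_m * 'I_m} :=
  [set (k, j) | j : 'I_m] :|: [set (j, k) | j : 'I_m].

Definition Omega m (r : nat) (k : 'I_m) : {set 'I_(m * r) * 'I_(m * r)} :=
  (\bigcup_(e in cross k) block_entries r e)%SET.

Definition restrict (R : nmodType) n (W : {set 'I_n * 'I_n}) (M : 'M[R]_n) :
    'M[R]_n :=
  \matrix_(i, j) if (i, j) \in W then M i j else 0.

Definition frobenius_norm (R : realType) p q (A : 'M[R]_(p, q)) : R :=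
  Num.sqrt (\sum_(i < p) \sum_(j < q) A i j ^+ 2).

Definition psd (R : realType) n (A : 'M[R]_n) : Prop :=
  A^T = A /\ forall v : 'cV[R]_n, 0 <= (v^T *m A *m v) 0 0.

Definition objective (R : realType) n r (W : {set 'I_n * 'I_n})
    (Mstar : 'M[R]_n) (X : 'M[R]_(n, r)) : R :=
  frobenius_norm (restrict W (X *m X^T - Mstar)) ^+ 2.

Definition gradient (R : realType) p q (f : 'M[R]_(p, q) -> R)
    (X : 'M[R]_(p, q)) : 'M[R]_(p, q) :=
  \matrix_(i, j) 'D_(delta_mx i j) f X.

(* The coordinates of 'M_(p, q) are numbered by 'I_(p * q) through vec_mx, so
   vec_mx (delta_mx 0 s) is the s-th elementary matrix. *)
Definition hessian (R : realType) p q (f : 'M[R]_(p, q) -> R)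
    (X : 'M[R]_(p, q)) : 'M[R]_(p * q) :=
  \matrix_(s, t) 'D_(vec_mx (delta_mx 0 s))
                   (fun Y => 'D_(vec_mx (delta_mx 0 t)) f Y) X.

(* 'D_v f X is a total operator; this definition is meant for twice continuously
   differentiable f, such as the polynomial objective above. *)
Definition second_order_critical (R : realType) p q (f : 'M[R]_(p, q) -> R)
    (X : 'M[R]_(p, q)) : Prop :=
  gradient f X = 0 /\ psd (hessian f X).

Definition global_minimum (R : realType) p q (f : 'M[R]_(p, q) -> R)
    (X : 'M[R]_(p, q)) : Prop :=
  forall Y : 'M[R]_(p, q), f X <= f Y.

(* Main.v *)
(* Let A be the k-th block of X and S the observed residual; a critical point
   satisfies S X = 0. If A is invertible, reading S X = 0 block by block gives
   S = 0. If A is singular, pick nonzero a and v with a A = 0 and A v = 0: the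
   Hessian along (E_k a + t E_i c) v^T, with i <> k, is affine in t because
   block (i, i) is unobserved and A v = 0, so its slope, a multiple of
   a S_{k,i} c = - a M*_{k,i} c, vanishes for every c, contradicting the
   invertibility of M*_{k,i}. *)
Require Import Defs.
From mathcomp Require Import ring lra zify.
Set Implicit Arguments.
Unset Strict Implicit.
Unset Printing Implicit Defensive.
Local Open Scope ring_scope.
Import Order.TTheory GRing.Theory Num.Theory.
Local Open Scope classical_set_scope.

(** * Directional derivatives along a line *)

(** For [h != 0] the difference quotient is exactly [P.[h]], and polynomials are continuous. This
    evaluates the total operator ['D] from an algebraic expansion, with no separate
    differentiability proof. *)
Lemma derive_poly_line (R : realType) p q (f : 'M[R]_(p, q) -> R)
    (X V : 'M[R]_(p, q)) (P : {poly R}) :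
  (forall h, f (h *: V + X) = f X + h * P.[h]) -> 'D_V f X = P.[0].
Proof.
move=> fE; apply/cvg_lim => //.
have Pc : horner P @ 0^' --> P.[0].
  exact: (cvg_trans (cvg_app _ (@nbhs_dnbhs _ _)) (@continuous_horner _ P 0)).
apply: cvg_trans Pc; apply: near_eq_cvg.
near=> h; rewrite /= /shift fE [f X + _]addrC addrK.
rewrite /GRing.scale /= mulKf //.
by near: h; exact: nbhs_dnbhs_neq.
Unshelve. all: by end_near. Qed.

(** * Frobenius inner product and restriction to observed entries *)

Definition mxdot (R : realType) p q (A B : 'M[R]_(p, q)) : R := \tr (A^T *m B).

Lemma mxdotE (R : realType) p q (A B : 'M[R]_(p, q)) :
  mxdot A B = \sum_(i < p) \sum_(j < q) A i j * B i j.
Proof.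
rewrite /mxdot /mxtrace exchange_big; apply: eq_bigr => j _.
by rewrite mxE; apply: eq_bigr => i _; rewrite mxE.
Qed.

Lemma mxdotC (R : realType) p q (A B : 'M[R]_(p, q)) : mxdot A B = mxdot B A.
Proof.
by rewrite !mxdotE; do 2!(apply: eq_bigr => ? _); rewrite mulrC.
Qed.

Lemma mxdotDr (R : realType) p q (A B C : 'M[R]_(p, q)) :
  mxdot A (B + C) = mxdot A B + mxdot A C.
Proof. by rewrite /mxdot mulmxDr mxtraceD. Qed.

Lemma mxdotZr (R : realType) p q a (A B : 'M[R]_(p, q)) :
  mxdot A (a *: B) = a * mxdot A B.
Proof. by rewrite /mxdot -scalemxAr mxtraceZ. Qed.

Lemma mxdotDl (R : realType) p q (A B C : 'M[R]_(p, q)) :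
  mxdot (A + B) C = mxdot A C + mxdot B C.
Proof. by rewrite mxdotC mxdotDr !(mxdotC C). Qed.

Lemma mxdotZl (R : realType) p q a (A B : 'M[R]_(p, q)) :
  mxdot (a *: A) B = a * mxdot A B.
Proof. by rewrite mxdotC mxdotZr mxdotC. Qed.

Section Restrict.
Context (R : realType) (n : nat) (W : {set 'I_n * 'I_n}).

Lemma restrictD (A B : 'M[R]_n) : restrict W (A + B) = restrict W A + restrict W B.
Proof. by apply/matrixP => i j; rewrite !mxE; case: ifP => _; rewrite ?addr0. Qed.

Lemma restrictZ a (A : 'M[R]_n) : restrict W (a *: A) = a *: restrict W A.
Proof. by apply/matrixP => i j; rewrite !mxE; case: ifP => _; rewrite ?mulr0. Qed.

Lemma mxdot_restrict (A B : 'M[R]_n) :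
  mxdot (restrict W A) (restrict W B) = mxdot (restrict W A) B.
Proof.
rewrite !mxdotE; do 2!(apply: eq_bigr => ? _); rewrite !mxE.
by case: ifP => // _; rewrite !mul0r.
Qed.

End Restrict.

(** The derivative of [X *m X^T] in the direction [Y], polarized into a symmetric bilinear map. *)
Definition symprod (R : realType) n r (X Y : 'M[R]_(n, r)) : 'M[R]_n :=
  X *m Y^T + Y *m X^T.

Lemma symprodDr (R : realType) n r (X Y Z : 'M[R]_(n, r)) :
  symprod X (Y + Z) = symprod X Y + symprod X Z.
Proof. by rewrite /symprod linearD /= mulmxDr mulmxDl addrACA. Qed.

Lemma symprodZr (R : realType) n r a (X Y : 'M[R]_(n, r)) :
  symprod X (a *: Y) = a *: symprod X Y.
Proof. by rewrite /symprod linearZ /= -scalemxAr -scalemxAl scalerDr. Qed.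

Lemma symprodC (R : realType) n r (X Y : 'M[R]_(n, r)) : symprod X Y = symprod Y X.
Proof. by rewrite /symprod addrC. Qed.

Lemma symprodDl (R : realType) n r (X Y Z : 'M[R]_(n, r)) :
  symprod (X + Y) Z = symprod X Z + symprod Y Z.
Proof. by rewrite symprodC symprodDr !(symprodC Z). Qed.

Lemma symprodZl (R : realType) n r a (X Y : 'M[R]_(n, r)) :
  symprod (a *: X) Y = a *: symprod X Y.
Proof. by rewrite symprodC symprodZr symprodC. Qed.

(** * Gradient and Hessian of the objective *)

Section Objective.
Context (R : realType) (n r : nat) (W : {set 'I_n * 'I_n}) (M : 'M[R]_n).
Implicit Types X U V : 'M[R]_(n, r).

Let residual X := restrict W (X *m X^T - M).

Lemma objectiveE X : objective W M X = mxdot (residual X) (residual X).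
Proof.
rewrite /objective /frobenius_norm sqr_sqrtr ?mxdotE.
  by do 2!(apply: eq_bigr => ? _); rewrite expr2.
by do 2!(apply: sumr_ge0 => ? _); rewrite sqr_ge0.
Qed.

Lemma residual_line X V h :
  residual (h *: V + X) =
  residual X + h *: restrict W (symprod X V) + h ^+ 2 *: restrict W (V *m V^T).
Proof.
rewrite /residual -!restrictZ -!restrictD; congr (restrict W _).
rewrite /symprod linearD linearZ /= !mulmxDl !mulmxDr -!scalemxAl -!scalemxAr.
by apply/matrixP => i j; rewrite !mxE; ring.
Qed.

Lemma derive_objective X V :
  'D_V (objective W M) X = 2 * mxdot (residual X) (symprod X V).
Proof.
rewrite -mxdot_restrict -/(residual X).
set G := residual X; set L := restrict W (symprod X V).
pose Q := restrict W (V *m V^T).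
(* The residual along the line is [G + h L + h^2 Q]. The polynomial is its squared norm minus that
   of [G], divided by [h]; only the constant term survives at 0. *)
rewrite (@derive_poly_line _ _ _ _ _ _ ((2 * mxdot G L)%:P
  + (mxdot L L + 2 * mxdot G Q) *: 'X + (2 * mxdot L Q) *: 'X^2
  + mxdot Q Q *: 'X^3)) => [|h];
  rewrite !(hornerD, hornerZ, hornerC, hornerX, hornerXn); first by ring.
rewrite !objectiveE residual_line -/G -/L -/Q.
rewrite !(mxdotDl, mxdotDr, mxdotZl, mxdotZr) (mxdotC L G) (mxdotC Q G) (mxdotC Q L).
ring.
Qed.

(** The product rule applied to [2 * mxdot (residual X) (symprod X V)]: one term differentiates the
    residual along [U], the other the factor [symprod X V]. *)
Definition hessian_form X U V : R :=
  2 * (mxdot (restrict W (symprod X U)) (restrict W (symprod X V))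
       + mxdot (residual X) (symprod U V)).

Lemma derive2_objective X U V :
  'D_U (fun Y => 'D_V (objective W M) Y) X = hessian_form X U V.
Proof.
rewrite (_ : (fun Y => _) = fun Y => 2 * mxdot (residual Y) (symprod Y V)); last first.
  by apply/funext => Y; exact: derive_objective.
pose Q := restrict W (U *m U^T).
rewrite (@derive_poly_line _ _ _ _ _ _ ((hessian_form X U V)%:P
  + (2 * (mxdot (restrict W (symprod X U)) (symprod U V) + mxdot Q (symprod X V))) *: 'X
  + (2 * mxdot Q (symprod U V)) *: 'X^2)) => [|h];
  rewrite !(hornerD, hornerZ, hornerC, hornerX, hornerXn); first by ring.
rewrite /hessian_form.
rewrite residual_line -/Q mxdot_restrict symprodDl symprodZl.
rewrite !(mxdotDl, mxdotDr, mxdotZl, mxdotZr).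
ring.
Qed.

Lemma hessian_formC X U V : hessian_form X U V = hessian_form X V U.
Proof. by rewrite /hessian_form mxdotC (symprodC U). Qed.

Lemma hessian_formZr X U a V : hessian_form X U (a *: V) = a * hessian_form X U V.
Proof. by rewrite /hessian_form !symprodZr restrictZ !mxdotZr; ring. Qed.

Lemma hessian_formDr X U V V' :
  hessian_form X U (V + V') = hessian_form X U V + hessian_form X U V'.
Proof.
by rewrite /hessian_form !symprodDr (restrictD _ (symprod X V)) mxdotDr
  (mxdotDr _ (symprod U V)); ring.
Qed.

Lemma hessian_form_add_sqr X U V t :
  hessian_form X (U + t *: V) (U + t *: V) =
  hessian_form X U U + t * (2 * hessian_form X U V) + t ^+ 2 * hessian_form X V V.
Proof.
rewrite hessian_formDr hessian_formZr !(hessian_formC X (U + _)).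
by rewrite !hessian_formDr !hessian_formZr (hessian_formC X V U); ring.
Qed.

(** Passes from the coordinate matrix [hessian] to arbitrary directions: expanding [V] in elementary
    matrices identifies its quadratic form at [mxvec V] with [hessian_form]. *)
Lemma hessian_form_ge0 X V : psd (hessian (objective W M) X) -> 0 <= hessian_form X V V.
Proof.
move=> [_ /(_ (mxvec V)^T)]; rewrite trmxK.
suff -> : (mxvec V *m hessian (objective W M) X *m (mxvec V)^T) 0 0
          = hessian_form X V V by [].
pose e s : 'M[R]_(n, r) := vec_mx (delta_mx 0 s).
have VE : V = \sum_s mxvec V 0 s *: e s.
  rewrite -[LHS]mxvecK [mxvec V in LHS]row_sum_delta linear_sum /=.
  by apply: eq_bigr => s _; rewrite linearZ.
have sumr U : hessian_form X U V = \sum_t mxvec V 0 t * hessian_form X U (e t).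
  rewrite {1}VE; elim/big_rec2: _ => [|t x Y _ <-].
    by rewrite -[0 in LHS](scale0r 0) hessian_formZr mul0r.
  by rewrite hessian_formDr hessian_formZr.
rewrite sumr !mxE; apply: eq_bigr => t _; rewrite hessian_formC sumr !mxE mulrC.
congr (_ * _); apply: eq_bigr => s _.
by rewrite [hessian _ _ _ _]mxE derive2_objective hessian_formC.
Qed.

(** The two summands of [symprod] are transposes of each other, so a symmetric [S] pairs equally
    with both. *)
Lemma mxdot_symprod (S : 'M[R]_n) U V :
  S^T = S -> mxdot S (symprod U V) = 2 * mxdot (S *m U) V.
Proof.
move=> Ssym; rewrite /mxdot /symprod mulmxDr mxtraceD Ssym !mulmxA.
rewrite [\tr (S *m V *m _)]mxtrace_mulC mulmxA -mxtrace_tr.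
by rewrite !trmx_mul !trmxK Ssym mulrDl mul1r mxtrace_mulC !mulmxA.
Qed.

(** By [mxdot_symprod], entry (i, j) of the gradient is 4 times that of [residual X *m X]. *)
Lemma gradient_residual X :
  (residual X)^T = residual X -> gradient (objective W M) X = 0 ->
  residual X *m X = 0.
Proof.
move=> Ssym g0; apply/matrixP => i j; rewrite [RHS]mxE.
have /matrixP/(_ i j) := g0; rewrite !mxE derive_objective mxdot_symprod // mxdotE.
rewrite (bigD1 i) //= (bigD1 j) //= big1 => [|l lj]; last first.
  by rewrite [X in _ * X]mxE (negbTE lj) andbF mulr0.
rewrite big1 => [|l li]; last first.
  by rewrite big1 // => ? _; rewrite [X in _ * X]mxE (negbTE li) mulr0.
rewrite [delta_mx _ _ _ _]mxE !eqxx mulr1 !addr0 mxE; lra.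
Qed.

End Objective.

(** * Block structure of matrices *)

Section Blocks.
Context (R : realType) (m r : nat).

Lemma block_index_inj (i j : 'I_m) (a b : 'I_r) :
  block_index i a = block_index j b -> i = j /\ a = b.
Proof.
move=> /(congr1 val)/= e.
have r0 : (0 < r)%N by apply: leq_ltn_trans (ltn_ord a).
have E : i = j :> nat.
  by have := congr1 (divn^~ r) e; rewrite !divnMDl // !divn_small // !addn0.
by split; apply: val_inj => //; move: e; rewrite E => /addnI.
Qed.

Lemma block_index_surj (p : 'I_(m * r)) :
  exists i : 'I_m, exists a : 'I_r, p = block_index i a.
Proof.
have r0 : (0 < r)%N by case: r p => [|//]; rewrite muln0 => -[].
have pm : (p %/ r < m)%N by rewrite ltn_divLR.
exists (Ordinal pm), (Ordinal (ltn_pmod p r0)).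
by apply: val_inj; rewrite /= -divn_eq.
Qed.

Lemma mem_Omega (k i j : 'I_m) (a b : 'I_r) :
  ((block_index i a, block_index j b) \in Omega r k) = (i == k) || (j == k).
Proof.
apply/bigcupP/idP => [[[i' j'] ik /imset2P[a' b' _ _ /=]]|].
  move=> e; have [-> _] := block_index_inj (congr1 fst e).
  have [-> _] := block_index_inj (congr1 snd e).
  by case/setUP: ik => /imsetP[l _ [-> ->]]; rewrite eqxx ?orbT.
move=> ijk; exists (i, j); last by apply/imset2P; exists a b.
rewrite inE; case/orP: ijk => /eqP ->; apply/orP.
  by left; apply/imsetP; exists j.
by right; apply/imsetP; exists i.
Qed.

(** The block unit vector E_i: left multiplication by its transpose extracts block row i. *)
Definition block_col (i : 'I_m) : 'M[R]_(m * r, r) := colsub (block_index i) 1%:M.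

Lemma blockE (S : 'M[R]_(m * r)) i j :
  block S i j = (block_col i)^T *m S *m block_col j.
Proof.
rewrite /block_col mulmx_colsub mulmx1 trmx_mxsub trmx1 mul_rowsub_mx mul1mx.
by apply/matrixP => a b; rewrite !mxE.
Qed.

Lemma tr_block_col_mul i j :
  (block_col i)^T *m block_col j = (i == j)%:R%:M.
Proof.
rewrite /block_col mulmx_colsub mulmx1; apply/matrixP => a b; rewrite !mxE.
have [<-|ij] := eqVneq i j.
  congr (_%:R); congr (nat_of_bool _).
  by apply/eqP/eqP => [/block_index_inj[]|->].
by case: eqP => [/block_index_inj[/esym/eqP]|]; rewrite ?(negbTE ij) ?mul0rn.
Qed.

Lemma block_eq0 (S : 'M[R]_(m * r)) : (forall i j, block S i j = 0) -> S = 0.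
Proof.
move=> S0; apply/matrixP => p q.
have [i [a ->]] := block_index_surj p; have [j [b ->]] := block_index_surj q.
by have /matrixP/(_ a b) := S0 i j; rewrite !mxE.
Qed.

(** A resolution of the identity; inserted between two factors, it turns their product into a sum
    over blocks. *)
Lemma block_col_tr_sum : \sum_j block_col j *m (block_col j)^T = 1%:M.
Proof.
apply/matrixP => p q; have [i [a ->]] := block_index_surj p.
rewrite summxE (bigD1 i) //= big1 => [|j ji].
  rewrite addr0 mxE (bigD1 a) //= big1 => [|b ba].
    by rewrite !mxE eqxx mul1r addr0 eq_sym.
  by rewrite !mxE; case: eqP => [/block_index_inj[_ ab]|_]; [rewrite ab eqxx in ba|rewrite mul0r].
rewrite mxE big1 // => b _.
by rewrite !mxE; case: eqP => [/block_index_inj[ij _]|_]; [rewrite ij eqxx in ji|rewrite mul0r].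
Qed.

Lemma block_restrict k (N : 'M[R]_(m * r)) i j :
  block (restrict (Omega r k) N) i j =
  if (i == k) || (j == k) then block N i j else 0.
Proof.
apply/matrixP => a b; rewrite !mxE mem_Omega.
by case: ifP; rewrite !mxE.
Qed.

Lemma restrict_Omega_sym k (N : 'M[R]_(m * r)) :
  N^T = N -> (restrict (Omega r k) N)^T = restrict (Omega r k) N.
Proof.
move=> Nsym; apply/matrixP => p q.
have [i [a ->]] := block_index_surj p; have [j [b ->]] := block_index_surj q.
by rewrite !mxE !mem_Omega orbC -[in RHS]Nsym mxE.
Qed.

End Blocks.

(** * Critical points for the cross pattern: invertible and singular pivot block *)

Section Completion.
Context (R : realType) (m r : nat) (k : 'I_m) (M : 'M[R]_(m * r)) (X : 'M[R]_(m * r, r)).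
Context (Msym : M^T = M).
Local Notation E := (@block_col R m r).
Let S := restrict (Omega r k) (X *m X^T - M).
Let A := (E k)^T *m X.

Lemma residual_sym : S^T = S.
Proof. by apply: restrict_Omega_sym; rewrite linearB /= trmx_mul trmxK Msym. Qed.

Lemma block_residualC i j : (block S i j)^T = block S j i.
Proof. by rewrite !blockE !trmx_mul trmxK residual_sym mulmxA. Qed.

Lemma critical_block_row i : S *m X = 0 -> \sum_j block S i j *m ((E j)^T *m X) = 0.
Proof.
move=> SX0; transitivity ((E i)^T *m S *m 1%:M *m X); last first.
  by rewrite mulmx1 -mulmxA SX0 mulmx0.
rewrite -block_col_tr_sum mulmx_sumr mulmx_suml.
by apply: eq_bigr => j _; rewrite blockE !mulmxA.
Qed.

(** For [i != k], block row i of [S *m X = 0] reduces to S_{i,k} A = 0, so S_{i,k} = 0, and S_{k,i}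
    = 0 by symmetry. Block row k then reduces to S_{k,k} A = 0. *)
Lemma residual_eq0 : S *m X = 0 -> A \in unitmx -> S = 0.
Proof.
move=> SX0 Au.
have pivot0 i : (forall j, j != k -> block S i j = 0) -> block S i k = 0.
  move=> S0; apply: (can_inj (mulmxK Au)); rewrite mul0mx.
  rewrite -(critical_block_row i SX0) (bigD1 k) //= big1 ?addr0 // => j jk.
  by rewrite S0 // mul0mx.
have off0 i j : i != k -> j != k -> block S i j = 0.
  by move=> ik jk; rewrite block_restrict (negbTE ik) (negbTE jk).
have Sik i : i != k -> block S i k = 0 by move=> ik; apply: pivot0 => j; exact: off0.
have Ski i : i != k -> block S k i = 0 by move=> ik; rewrite -block_residualC Sik // trmx0.
apply: block_eq0 => i j; have [->|ik] := eqVneq i k; have [->|jk] := eqVneq j k.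
- exact: pivot0.
- exact: Ski.
- exact: Sik.
- exact: off0.
Qed.

(** A function that is affine in t and nonnegative for all t has slope 0. The vector [a] is
    arbitrary here; its choice in the left kernel of A later turns S_{k,i} into a block of [M]. *)
Lemma singular_pivot_block i (a v : 'rV[R]_r) :
  (forall V, 0 <= hessian_form (Omega r k) M X V V) ->
  i != k -> v != 0 -> v *m A^T = 0 -> a *m block S k i = 0.
Proof.
move=> H ik v0 vA; apply/rowP => j; rewrite [RHS]mxE.
pose c : 'cV[R]_r := delta_mx j 0.
have <- : (a *m block S k i *m c) 0 0 = (a *m block S k i) 0 j.
  by rewrite -colE mxE.
pose D0 := E k *m a^T *m v; pose D1 := E i *m c *m v.
have XvE : (E k)^T *m (X *m v^T) = 0.
  by rewrite mulmxA -/A -[A]trmxK -trmx_mul vA trmx0.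
have Eki : (E k)^T *m E i = 0 by rewrite tr_block_col_mul eq_sym (negbTE ik) raddf0.
have Eik : (E i)^T *m E k = 0 by rewrite tr_block_col_mul (negbTE ik) raddf0.
(* Moving along [D1] changes no observed entry to first order: in block row or column k, one summand
   dies because A v^T = 0, the other because E_i and E_k are orthogonal. *)
have XD1 : restrict (Omega r k) (symprod X D1) = 0.
  apply: block_eq0 => p q; rewrite block_restrict; case: ifP => // pqk.
  rewrite blockE /symprod /D1 !trmx_mul mulmxDr mulmxDl !mulmxA.
  case/orP: pqk => /eqP->.
    by rewrite -[(E k)^T *m X *m _]mulmxA XvE Eki !mul0mx addr0.
  rewrite -!mulmxA Eik.
  have vXE : v *m (X^T *m E k) = 0 by rewrite -vA /A trmx_mul trmxK.
  by rewrite vXE !mulmx0 addr0.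
(* Used twice: [l = i], [b = c^T] gives the t^2 coefficient, zero since block (i, i) is unobserved;
   [l = k], [b = a] gives the slope. *)
have SD (l : 'I_m) (b : 'rV_r) : mxdot (S *m (E l *m b^T *m v)) D1
    = (v *m v^T) 0 0 * (b *m block S l i *m c) 0 0.
  rewrite /mxdot /D1 !trmx_mul !trmxK residual_sym blockE.
  transitivity (\tr (v *m v^T *m (b *m ((E l)^T *m S *m E i) *m c))).
    by rewrite !mulmxA mxtrace_mulC !mulmxA.
  by rewrite {1}[v *m v^T]mx11_scalar mul_scalar_mx mxtraceZ [\tr _]big_ord1.
have H11 : hessian_form (Omega r k) M X D1 D1 = 0.
  rewrite /hessian_form XD1 mxdot_symprod ?residual_sym // -/S.
  have := SD i c^T; rewrite trmxK -/D1 => ->.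
  rewrite block_restrict (negbTE ik) /= mulmx0 mul0mx [fun_of_matrix 0 _ _]mxE.
  by rewrite /mxdot mulmx0 mxtrace0; ring.
pose h01 := (v *m v^T) 0 0 * (a *m block S k i *m c) 0 0.
have H01 : hessian_form (Omega r k) M X D0 D1 = 4 * h01.
  rewrite /hessian_form XD1 mxdot_symprod ?residual_sym // -/S SD -/h01.
  by rewrite /mxdot mulmx0 mxtrace0; ring.
have h010 : h01 = 0.
  have line t : 0 <= hessian_form (Omega r k) M X D0 D0 + t * (8 * h01).
    have := H (D0 + t *: D1).
    rewrite (hessian_form_add_sqr _ _ _ D0 D1) H01 H11; lra.
  apply/eqP/negPn/negP => h0.
  (* This t makes the affine function equal to -1. *)
  have := line (- (hessian_form (Omega r k) M X D0 D0 + 1) / (8 * h01)).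
  rewrite divfK; last by rewrite mulf_neq0 // pnatr_eq0.
  by rewrite opprD addrA subrr sub0r oppr_ge0 ler10.
(* The factor [v *m v^T] is a sum of real squares, nonzero since [v != 0]. *)
move: h010 => /eqP; rewrite mulf_eq0 => /orP[/eqP vv|/eqP//].
case/negP: v0; apply/eqP/rowP => l; rewrite mxE.
have v2 l' : true -> 0 <= v 0 l' * v^T l' 0 by rewrite mxE -expr2 sqr_ge0.
have /(psumr_eq0P v2)/(_ l isT) : \sum_l' v 0 l' * v^T l' 0 = 0 by move: vv; rewrite mxE.
by rewrite mxE => /eqP; rewrite mulf_eq0 orbb => /eqP.
Qed.

End Completion.

Theorem proposition2 (R : realType) (m r : nat) (hm : (2 * r <= m)%N) (k : 'I_m)
    (Mstar : 'M[R]_(m * r))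
    (Mpsd : psd Mstar)
    (Mrank : \rank Mstar = r)
    (blockrank : forall i j : 'I_m, \rank (block Mstar i j) = r)
    (X : 'M[R]_(m * r, r)) :
  second_order_critical (objective (r := r) (Omega r k) Mstar) X ->
  global_minimum (objective (r := r) (Omega r k) Mstar) X.
Proof.
move=> [g0 hess]; have [Msym _] := Mpsd.
have SX0 := gradient_residual (residual_sym k X Msym) g0.
have [Au|As] := boolP ((block_col R r k)^T *m X \in unitmx).
  (* With zero residual the objective is 0, a lower bound for a squared norm. *)
  move=> Y; rewrite objectiveE (residual_eq0 Msym SX0 Au) /mxdot mulmx0 mxtrace0.
  by rewrite /objective exprn_ge0 // sqrtr_ge0.
have detA : \det ((block_col R r k)^T *m X) = 0.
  by move: As; rewrite unitmxE unitfE negbK => /eqP.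
have /eqP/det0P[a a0 aA] := detA.
have /eqP/det0P[v v0 vA] : \det ((block_col R r k)^T *m X)^T = 0 by rewrite det_tr.
(* A nonzero [a] forces [r > 0], so [2 * r <= m] gives [m >= 2] and a block index other than [k]. *)
have r0 : (0 < r)%N.
  by case: (r) a a0 {aA} => // a; rewrite [a]thinmx0 eqxx.
have [i ik] : exists i : 'I_m, i != k.
  have m1 : (1 < m)%N by lia.
  have m0 : (0 < m)%N by lia.
  have [k0|k0] := eqVneq (k : nat) 0%N.
    by exists (Ordinal m1); rewrite -val_eqE /= k0.
  by exists (Ordinal m0); rewrite -val_eqE /= eq_sym.
have := singular_pivot_block Msym a (fun V => hessian_form_ge0 V hess) ik v0 vA.
rewrite block_restrict eqxx /= => aS.
(* Block (k, i) of [X *m X^T] starts with the factor A, which [a] annihilates. *)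
have aM : a *m block Mstar k i = 0.
  move: aS; rewrite !blockE mulmxBr mulmxBl mulmxBr !mulmxA.
  rewrite -[a *m _ *m X]mulmxA aA !mul0mx sub0r => /eqP.
  by rewrite oppr_eq0 => /eqP.
have /row_free_inj/(_ a 0) : row_free (block Mstar k i) by rewrite /row_free blockrank.
by rewrite aM mul0mx => /(_ erefl) a00; rewrite a00 eqxx in a0.
Qed.
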